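(* Suppose that $\boldsymbol{X}\in[q]^N$ is sampled from the Curie–Weiss Potts model $\mathbb{P}^{\mathrm{CW}}_{\beta,\boldsymbol{B}}$ and, conditional on $\boldsymbol{X}$, let $Z_1,\dots,Z_q$ be independent random variables with $Z_r\sim N(\bar X_r,(\beta N)^{-1})$. Let $\boldsymbol{Z}:=(Z_1,\dots,Z_q)$ and $\bar{\boldsymbol{X}}:=(\bar X_1,\dots,\bar X_q)$. (i) Suppose that $(\beta,\boldsymbol{B})\in(0,\infty)\times\mathbb{R}^{q-1}$ is such that the function $$H_{\beta,\boldsymbol{B}}(\boldsymbol{t}):=\frac\beta2\sum_{r=1}^qt_r^2+\sum_{r=1}^qB_rt_r-\sum_{r=1}^qt_r\log t_r$$ has a unique global maximizer $\boldsymbol{m}$ on the set $\mathcal{P}([q])$. (ii) Suppose further that the quadratic form $\boldsymbol{u}^\top\nabla^2H_{\beta,\boldsymbol{B}}(\boldsymbol{m})\boldsymbol{u}$ is strictly negative for all $\boldsymbol{u}\in T:=\{\boldsymbol{u}\in\mathbb{R}^q\setminus\{\boldsymbol 0\}:\sum_{r=1}^qu_r=0\}$. Then both the random variables $\sqrt N(\bar{\boldsymbol{X}}-\boldsymbol{m})$ and $\sqrt N(\boldsymbol{Z}-\boldsymbol{m})$ are tight (as $N\to\infty$).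
   Context: Fix an integer $q\ge2$; $[q]=\{1,\dots,q\}$; $\mathcal{P}([q]):=\{\boldsymbol{v}\in[0,1]^q:\sum_{r=1}^qv_r=1\}$; conventions $B_q:=0$, $0\log0:=0$. For $\boldsymbol{x}\in[q]^N$, $\bar x_r:=\frac1N\sum_{i=1}^N\mathbf 1_{x_i=r}$. The Curie–Weiss Potts model is the probability mass function on $[q]^N$ $$\mathbb{P}^{\mathrm{CW}}_{\beta,\boldsymbol{B}}(\boldsymbol{x})=\frac1{Z_N^{\mathrm{CW}}(\beta,\boldsymbol{B})}\exp\Big(\frac{N\beta}2\sum_{r=1}^q\bar x_r^2+N\sum_{r=1}^qB_r\bar x_r\Big),$$ with $Z_N^{\mathrm{CW}}$ the normalizing constant. $\nabla^2H_{\beta,\boldsymbol{B}}(\boldsymbol{t})=\mathrm{diag}((\beta-t_r^{-1})_{1\le r\le q})$ is the ambient Hessian in $\mathbb{R}^q$. $N(\mu,\sigma^2)$ is the normal law with mean $\mu$ and variance $\sigma^2$. *)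

(* Defs.v *)
From HB Require Import structures.
From mathcomp Require Import all_boot all_order all_algebra.
From mathcomp Require Import all_classical all_reals all_analysis.

Set Implicit Arguments.
Unset Strict Implicit.
Unset Printing Implicit Defensive.

Import Order.TTheory GRing.Theory Num.Theory.
Import numFieldNormedType.Exports.

Local Open Scope classical_set_scope.
Local Open Scope ring_scope.

(* Colours [q] are 'I_q, and a spin configuration in [q]^N is a finite function
   {ffun 'I_N -> 'I_q}. *)

Section potts.
Context {R : realType} (q : nat).

Definition prob_simplex : set 'rV[R]_q :=
  [set v | (forall r, 0 <= v 0 r <= 1) /\ \sum_(r < q) v 0 r = 1].

(* The field B lies in R^(q-1); it is extended to all colours by B_q = 0. *)
Definition field_ext (B : 'rV[R]_q.-1) (r : 'I_q) : R :=
  if (insub (val r) : option 'I_q.-1) is Some i then B 0 i else 0.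

Definition prop_vec N (x : {ffun 'I_N -> 'I_q}) : 'rV[R]_q :=
  \row_r (N%:R^-1 * \sum_(i < N) (x i == r)%:R).

Definition cw_weight (beta : R) (B : 'rV[R]_q.-1) N
    (x : {ffun 'I_N -> 'I_q}) : R :=
  expR (N%:R * beta / 2 * \sum_(r < q) (prop_vec x) 0 r ^+ 2
        + N%:R * \sum_(r < q) field_ext B r * (prop_vec x) 0 r).

Definition cw_partition beta (B : 'rV[R]_q.-1) N : R :=
  \sum_(x : {ffun 'I_N -> 'I_q}) cw_weight beta B x.

Definition cw_pmf beta (B : 'rV[R]_q.-1) N (x : {ffun 'I_N -> 'I_q}) : R :=
  (cw_partition beta B N)^-1 * cw_weight beta B x.

(* The convention 0 log 0 = 0 holds automatically. *)
Definition cw_H (beta : R) (B : 'rV[R]_q.-1) (t : 'rV[R]_q) : R :=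
  beta / 2 * \sum_(r < q) t 0 r ^+ 2 + \sum_(r < q) field_ext B r * t 0 r
  - \sum_(r < q) t 0 r * ln (t 0 r).

(* The ambient Hessian of cw_H in R^q; meaningful for t with positive
   coordinates only. *)
Definition cw_hessian (beta : R) (t : 'rV[R]_q) : 'M[R]_q :=
  diag_mx (\row_r (beta - (t 0 r)^-1)).

End potts.

Arguments prob_simplex : clear implicits.

Definition global_maximizer {R : realType} {U : Type} (f : U -> R) (A : set U)
    (m : U) : Prop :=
  A m /\ forall t, A t -> f t <= f m.

Definition unique_global_maximizer {R : realType} {U : Type} (f : U -> R)
    (A : set U) (m : U) : Prop :=
  global_maximizer f A m /\ forall m', global_maximizer f A m' -> m' = m.

Section sampling.
Context {R : realType}.

Definition cond_prob d (T : measurableType d) (P : probability T R)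
    (E F : set T) : R :=
  fine (P (E `&` F)) / fine (P F).

(* X has the Curie-Weiss Potts law on [q]^N; given X, the coordinates Z r are
   independent and Z r has law N(xbar_r, (beta N)^-1).  The second parameter of
   normal_prob is the standard deviation. *)
Record cw_gaussian_sample (q N : nat) (beta : R) (B : 'rV[R]_q.-1)
    d (T : measurableType d) (P : probability T R)
    (X : T -> {ffun 'I_N -> 'I_q}) (Z : 'I_q -> {RV P >-> R}) : Prop := {
  cw_sample_measurable :
    forall A : set {ffun 'I_N -> 'I_q}, measurable (X @^-1` A) ;
  cw_sample_law :
    forall x, P (X @^-1` [set x]) = (cw_pmf beta B x)%:E ;
  cw_sample_cond_normal :
    forall x (r : 'I_q) (A : set R), measurable A ->
      (cond_prob P (Z r @^-1` A) (X @^-1` [set x]))%:E =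
      normal_prob (prop_vec x 0 r) (Num.sqrt (beta * N%:R)^-1) A ;
  cw_sample_cond_indep :
    forall x (A : 'I_q -> set R), (forall r, measurable (A r)) ->
      cond_prob P (\bigcap_(r in [set: 'I_q]) (Z r @^-1` A r))
        (X @^-1` [set x]) =
      \prod_(r < q) cond_prob P (Z r @^-1` A r) (X @^-1` [set x]) }.

(* Tightness of a sequence of random vectors (Y N)_(N >= 1), each possibly
   defined on its own probability space. *)
Definition tight_seq (q : nat) (d : nat -> measure_display)
    (T : forall N, measurableType (d N)) (P : forall N, probability (T N) R)
    (Y : forall N, T N -> 'rV[R]_q) : Prop :=
  forall eps : R, 0 < eps ->
    exists K : set 'rV[R]_q, compact K /\
      forall N, (0 < N)%N -> (P N (Y N @^-1` (~` K)) <= eps%:E)%E.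

End sampling.

(* Main.v *)
(* Write G = sqrt N * (xbar - m).  Criticality of the maximiser m gives
   exp (beta * m_r + B_r) = m_r * exp L, so the Curie-Weiss weight of x is, up to
   a factor depending on N only, prod_i m_(x i) * exp (beta / 2 * |G|^2): the model
   is the i.i.d. law m tilted by exp (beta / 2 * |G|^2), and its normalising
   constant is at least 1 (relative to that factor).  It therefore suffices to
   bound E exp (b' / 2 * |G|^2) under the i.i.d. law uniformly in N for some
   b' > beta.  Since cw_H m - cw_H t = KL (t | m) - beta / 2 * |t - m|^2, the
   assumptions (i) and (ii) give KL (t | m) >= b / 2 * |t - m|^2 on the simplex for
   some b > beta; by duality the centred i.i.d. moment generating function is at
   most exp (|s|^2 / (2 b)).  Linearising exp (b' / 2 * |G|^2) by a sum of
   exponentials of linear forms over the lattice of integer points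
   (a discrete Hubbard-Stratonovich transform) then gives the bound for
   beta < b' < b.  No Stirling formula is involved, which is why no polynomial
   factor in N is lost. *)
Require Import Defs.
From HB Require Import structures.
From mathcomp Require Import all_boot all_order all_algebra.
From mathcomp Require Import all_classical all_reals all_analysis.
From mathcomp Require Import measurable_realfun ring lra.

Set Implicit Arguments.
Unset Strict Implicit.
Unset Printing Implicit Defensive.

Import Order.TTheory GRing.Theory Num.Theory.
Import numFieldNormedType.Exports.

Local Open Scope classical_set_scope.
Local Open Scope ring_scope.


Lemma xlnx_ge_tangent (R : realType) (x y : R) :
  0 <= x -> 0 < y -> x * ln y + x - y <= x * ln x.
Proof.
rewrite le_eqVlt => /predU1P[<-|x0] y0; first by rewrite !mul0r; lra.
have yx0 : 0 < y / x by rewrite divr_gt0.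
have h : ln (y / x) <= y / x - 1.
  by have := @le_ln1Dx R (y / x - 1); rewrite [1 + _]addrC subrK; apply; lra.
rewrite ln_div ?posrE// in h.
have := ler_wpM2l (ltW x0) h.
have -> : x * (y / x - 1) = y - x by field; rewrite gt_eqF.
lra.
Qed.

Lemma sum_perturb2 (R : realType) (q : nat) (h : 'I_q -> R -> R)
    (t m : 'I_q -> R) (r s : 'I_q) : r != s ->
  (forall i, i != r -> i != s -> t i = m i) ->
  \sum_i h i (t i) - \sum_i h i (m i) =
  (h r (t r) - h r (m r)) + (h s (t s) - h s (m s)).
Proof.
move=> rs tm; rewrite -sumrB (bigD1 r)//= (bigD1 s) 1?eq_sym//= big1 ?addr0//.
by move=> i /andP[ir is_]; rewrite tm// subrr.
Qed.

Definition KL_div {R : realType} (q : nat) (t m : 'rV[R]_q) : R :=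
  \sum_r t 0 r * (ln (t 0 r) - ln (m 0 r)).

Section maximizer.
Context {R : realType} (q : nat) (beta : R) (B : 'rV[R]_q.-1).

Definition cw_H_coord (r : 'I_q) (y : R) : R :=
  beta / 2 * y ^+ 2 + field_ext B r * y - y * ln y.

Lemma cw_H_sum (t : 'rV[R]_q) : cw_H beta B t = \sum_r cw_H_coord r (t 0 r).
Proof.
by rewrite /cw_H mulr_sumr -big_split -sumrB.
Qed.

(* Moving a mass [e] from colour [r] to colour [s] does not increase cw_H; the
   entropy is bounded below by its tangents at the new point, so that no limit
   of difference quotients is needed and [m 0 s = 0] is allowed. *)
Lemma maximizer_exchange (m : 'rV[R]_q) (r s : 'I_q) : 0 < beta ->
  global_maximizer (cw_H beta B) (prob_simplex R q) m ->
  m 0 r * expR (beta * m 0 s + field_ext B s) <=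
  m 0 s * expR (beta * m 0 r + field_ext B r).
Proof.
move=> beta0 [[m01 m1] mmax].
have [->//|rs] := eqVneq r s.
have mr0 : 0 <= m 0 r by have /andP[] := m01 r.
have ms0 : 0 <= m 0 s by have /andP[] := m01 s.
move: mr0; rewrite le_eqVlt => /predU1P[<-|mr0].
  by rewrite mul0r mulr_ge0// expR_ge0.
have step e : 0 < e -> e < m 0 r ->
    (m 0 r - e) * expR (beta * (m 0 s - m 0 r) + field_ext B s - field_ext B r)
    <= m 0 s + e.
  move=> e0 er.
  pose t := \row_i (if i == r then m 0 r - e else
                    if i == s then m 0 s + e else m 0 i) : 'rV[R]_q.
  have tr : t 0 r = m 0 r - e by rewrite mxE eqxx.
  have ts : t 0 s = m 0 s + e by rewrite mxE eq_sym (negbTE rs) eqxx.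
  have ti i : i != r -> i != s -> t 0 i = m 0 i.
    by move=> /negbTE ir /negbTE is_; rewrite mxE ir is_.
  have t1 : \sum_i t 0 i = 1.
    rewrite -m1; apply/eqP; rewrite -subr_eq0.
    rewrite (sum_perturb2 (fun _ y => y) (t := t 0) (m := m 0) rs ti).
    by rewrite tr ts; apply/eqP; ring.
  have t0 i : 0 <= t 0 i.
    rewrite mxE; case: ifP => _; first lra.
    case: ifP => _; first lra.
    by have /andP[] := m01 i.
  have tS : prob_simplex R q t.
    split => // i; rewrite t0/= -t1 (bigD1 i)//= lerDl.
    by apply: sumr_ge0.
  have := mmax _ tS; rewrite -subr_le0 !cw_H_sum.
  rewrite (sum_perturb2 _ (t := t 0) (m := m 0) rs ti) tr ts /cw_H_coord.
  have re0 : 0 < m 0 r - e by lra.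
  have se0 : 0 < m 0 s + e by lra.
  have := xlnx_ge_tangent (ltW mr0) re0.
  have := xlnx_ge_tangent ms0 se0.
  move=> h1 h2 h3.
  rewrite -ler_ln ?posrE ?mulr_gt0 ?expR_gt0// lnM ?posrE ?expR_gt0// expRK.
  rewrite -(ler_pM2l e0).
  have : 0 <= beta * e ^+ 2 by rewrite mulr_ge0 ?sqr_ge0// ltW.
  lra.
have main : m 0 r * expR (beta * (m 0 s - m 0 r) + field_ext B s - field_ext B r)
    <= m 0 s.
  set E := expR _ in step *.
  have E0 : 0 < E by rewrite expR_gt0.
  rewrite leNgt; apply/negP => lt.
  have E1 : 0 < 2 * (1 + E) by lra.
  pose e := (m 0 r * E - m 0 s) / (2 * (1 + E)).
  have eE : e * (2 * (1 + E)) = m 0 r * E - m 0 s.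
    by rewrite /e divfK// gt_eqF.
  have e0 : 0 < e by rewrite divr_gt0// subr_gt0.
  have em : e < m 0 r by rewrite ltr_pdivrMr//; nra.
  have := step _ e0 em; nra.
have -> : beta * m 0 s + field_ext B s =
  (beta * (m 0 s - m 0 r) + field_ext B s - field_ext B r) +
  (beta * m 0 r + field_ext B r) by ring.
by rewrite expRD mulrA ler_pM2r// expR_gt0.
Qed.

Context (m : 'rV[R]_q) (beta0 : 0 < beta).
Context (mmax : global_maximizer (cw_H beta B) (prob_simplex R q) m).

Lemma maximizer_gibbs : exists L : R, forall r,
  0 < m 0 r /\ ln (m 0 r) = beta * m 0 r + field_ext B r - L.
Proof.
pose a r := expR (beta * m 0 r + field_ext B r).
have a0 r : 0 < a r by exact: expR_gt0.
have [[_ m1] _] := mmax.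
have ma s : m 0 s * \sum_r a r = a s.
  rewrite -[RHS]mul1r -m1 mulr_sumr mulr_suml; apply: eq_bigr => r _.
  by apply/le_anti; rewrite !(maximizer_exchange _ _ beta0 mmax).
have S0 (r : 'I_q) : 0 < \sum_r a r.
  by rewrite (bigD1 r)//= ltr_pwDl// sumr_ge0// => i _; exact: ltW.
exists (ln (\sum_r a r)) => r.
have m0 : 0 < m 0 r by rewrite -(pmulr_lgt0 _ (S0 r)) ma.
split => //.
have : ln (m 0 r * \sum_r a r) = ln (a r) by rewrite ma.
by rewrite lnM ?posrE ?(S0 r)// expRK => <-; rewrite addrK.
Qed.

Lemma cw_H_KL (t : 'rV[R]_q) : \sum_r t 0 r = 1 ->
  cw_H beta B m - cw_H beta B t =
  KL_div t m - beta / 2 * \sum_r (t 0 r - m 0 r) ^+ 2.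
Proof.
move=> t1; have [L hL] := maximizer_gibbs.
have [[_ m1] _] := mmax.
apply/eqP; rewrite -subr_eq0; apply/eqP.
rewrite !cw_H_sum /cw_H_coord /KL_div mulr_sumr -!sumrB.
transitivity (\sum_r (- L * (t 0 r - m 0 r))); last first.
  by rewrite -mulr_sumr sumrB t1 m1 subrr mulr0.
by apply: eq_bigr => r _; rewrite (hL r).2; field.
Qed.

End maximizer.

Lemma xlnx_ge_local (R : realType) (eta y : R) : 0 < eta < 1 ->
  0 <= y <= 1 + eta ->
  (1 - eta) / 2 * (y - 1) ^+ 2 <= y * ln y - (y - 1).
Proof.
move=> /andP[eta0 eta1] /andP[+ y1]; rewrite le_eqVlt => /predU1P[<-|y0].
  rewrite mul0r; nra.
pose g (x : R) : R := x * ln x - (x - 1) - (1 - eta) / 2 * (x - 1) ^+ 2.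
pose g' (x : R) : R := ln x - (1 - eta) * (x - 1).
have g1 : g 1 = 0 by rewrite /g ln1; ring.
have dg (x : R) : 0 < x -> is_derive x 1 g (g' x).
  move=> x0; have dl : is_derive x (1 : R) (@ln R) x^-1 by exact: is_derive1_ln.
  apply: is_derive_eq.
  rewrite /g' /GRing.scale/=; field; rewrite gt_eqF//.
have cg (x : R) : 0 < x -> {for x, continuous g}.
  move=> x0; apply: differentiable_continuous; apply/derivable1_diffP.
  by have [] := dg _ x0.
suff : 0 <= g y by rewrite /g; lra.
have [y_1|y_1|->] := ltgtP y 1; last by rewrite g1.
- have [z /[!in_itv]/= /andP[z1 z2] E] :
      exists2 c, c \in `]y, 1[%R & g 1 - g y = g' c * (1 - y).
    apply: MVT => //.
      by move=> x /[!in_itv]/= /andP[x1 _]; apply: dg; lra.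
    apply: continuous_in_subspaceT => x /[!inE]/= /[!in_itv]/= /andP[x1 _].
    by apply: cg; lra.
  have : g' z <= 0.
    have := @le_ln1Dx R (z - 1); rewrite [1 + _]addrC subrK /g' => h.
    have {}h : ln z <= z - 1 by apply: h; lra.
    nra.
  rewrite g1 in E; nra.
- have [z /[!in_itv]/= /andP[z1 z2] E] :
      exists2 c, c \in `]1, y[%R & g y - g 1 = g' c * (y - 1).
    apply: MVT => //.
      by move=> x /[!in_itv]/= /andP[x1 _]; apply: dg; lra.
    apply: continuous_in_subspaceT => x /[!inE]/= /[!in_itv]/= /andP[x1 _].
    by apply: cg; lra.
  have : 0 <= g' z.
    have z0 : 0 < z by lra.
    have := @le_ln1Dx R (z^-1 - 1); rewrite [1 + _]addrC subrK /g' lnV ?posrE// => h.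
    have zi : 0 < z^-1 by rewrite invr_gt0.
    have {}h : - ln z <= z^-1 - 1 by apply: h; lra.
    have zz : z * z^-1 = 1 by rewrite divff// gt_eqF.
    have : (1 - eta) <= z^-1.
      have : (1 - eta) * z <= 1 by nra.
      by rewrite -ler_pdivlMr// div1r.
    nra.
  rewrite g1 in E; nra.
Qed.

Lemma compact_rV_box (R : realType) (q : nat) (M : R) :
  compact [set v : 'rV[R]_q | forall r, `|v 0 r| <= M].
Proof.
have -> : [set v : 'rV[R]_q | forall r, `|v 0 r| <= M] =
    [set v | forall r, `[- M, M]%classic (v ord0 r)].
  apply/seteqP; split => v /= vM r.
    by rewrite in_itv/= -ler_norml.
  by have := vM r; rewrite in_itv/= -ler_norml.
by apply: (@rV_compact _ _ (fun=> `[- M, M]%classic)) => r; exact: segment_compact.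
Qed.

Lemma continuous_sum (R : realType) (T : topologicalType) (q : nat)
    (f : 'I_q -> T -> R) :
  (forall r, continuous (f r)) -> continuous (fun v => \sum_r f r v).
Proof.
move=> cf; apply: continuous_big => //; exact: add_continuous.
Qed.

Lemma closed_eq_continuous (R : realType) (T : topologicalType) (f : T -> R)
    (a : R) : continuous f -> closed [set v | f v = a].
Proof.
move=> cf; by apply: (@preimage_closed _ _ f [set a]).
Qed.

Lemma closed_ge_continuous (R : realType) (T : topologicalType) (f : T -> R)
    (a : R) : continuous f -> closed [set v | a <= f v].
Proof.
by move=> cf; apply: (@preimage_closed _ _ f [set x | a <= x]).
Qed.

Lemma sumsq_eq0 (R : realType) (q : nat) (u : 'rV[R]_q) :
  (\sum_r u 0 r ^+ 2 == 0) = (u == 0).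
Proof.
apply/eqP/eqP => [u0|->]; last by apply: big1 => r _; rewrite mxE expr0n.
apply/rowP => r; rewrite mxE; apply/eqP; rewrite -sqrf_eq0.
by apply/eqP; apply: (psumr_eq0P _ u0) => // i _; exact: sqr_ge0.
Qed.

Lemma sumsq_ge (R : realType) (q : nat) (u : 'I_q -> R) r :
  u r ^+ 2 <= \sum_r u r ^+ 2.
Proof. by rewrite (bigD1 r)//= lerDl sumr_ge0// => i _; exact: sqr_ge0. Qed.

Lemma continuous_coord (R : realType) (q : nat) (r : 'I_q) (f : R -> R) :
  continuous f -> continuous (fun v : 'rV[R]_q => f (v 0 r)).
Proof.
move=> cf v; apply: (@continuous_comp _ _ _ (fun v : 'rV[R]_q => v 0 r) f).
  exact: coord_continuous.
exact: cf.
Qed.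

Lemma continuous_scaled_sqr (R : realType) (a b : R) :
  continuous (fun x : R => b * (x - a) ^+ 2).
Proof.
move=> x; apply: cvgM; first exact: cvg_cst.
apply: (@continuous_comp _ _ _ (fun x : R => x - a) (fun x => x ^+ 2)).
  by apply: cvgB; [exact: cvg_id|exact: cvg_cst].
exact: exprn_continuous.
Qed.

Lemma hessian_coercive (R : realType) (q : nat) (c : 'I_q -> R) :
  (forall u : 'rV[R]_q, u != 0 -> \sum_r u 0 r = 0 ->
    0 < \sum_r c r * u 0 r ^+ 2) ->
  exists2 k : R, 0 < k & forall u : 'rV[R]_q, \sum_r u 0 r = 0 ->
    k * \sum_r u 0 r ^+ 2 <= \sum_r c r * u 0 r ^+ 2.
Proof.
move=> cpos.
have csq b r : continuous (fun v : 'rV[R]_q => b * v 0 r ^+ 2).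
  apply: (@continuous_coord _ _ _ (fun x => b * x ^+ 2)).
  have -> : (fun x : R => b * x ^+ 2) = (fun x => b * (x - 0) ^+ 2).
    by apply/funext => x; rewrite subr0.
  exact: continuous_scaled_sqr.
pose A := [set u : 'rV[R]_q | \sum_r u 0 r = 0] `&`
          [set u : 'rV[R]_q | \sum_r u 0 r ^+ 2 = 1].
have cA : compact A.
  apply: (subclosed_compact _ (@compact_rV_box R q 1)).
    apply: closedI; apply: closed_eq_continuous; apply: continuous_sum => r.
      exact: coord_continuous.
    by under eq_fun do rewrite -[_ ^+ 2]mul1r; exact: csq.
  move=> u [_ /= u1] r.
  rewrite -(@ler_pXn2r _ 2)// ?nnegrE//= real_normK ?num_real// expr1n -u1.
  exact: (sumsq_ge (u 0)).
have scale (u : 'rV[R]_q) : u != 0 -> \sum_r u 0 r = 0 ->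
    A ((Num.sqrt (\sum_r u 0 r ^+ 2))^-1 *: u).
  move=> u0 us; split => /=.
    under eq_bigr do rewrite mxE.
    by rewrite -mulr_sumr us mulr0.
  under eq_bigr do rewrite mxE exprMn.
  rewrite -mulr_sumr exprVn sqr_sqrtr ?sumr_ge0// => [|r _]; last exact: sqr_ge0.
  by rewrite mulVf// sumsq_eq0.
have c0 (c' : 'I_q -> R) : \sum_r c' r * (0 : 'rV[R]_q) 0 r ^+ 2 = 0.
  by apply: big1 => r _; rewrite mxE expr0n mulr0.
have s0 : \sum_r (0 : 'rV[R]_q) 0 r ^+ 2 = 0 by apply/eqP; rewrite sumsq_eq0.
have [[v0 Av0]|/set0P/negP/negPn/eqP A0] := pselect (A !=set0); last first.
  exists 1 => // u us; have [->|u0] := eqVneq u 0.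
    by rewrite c0 s0 mulr0.
  by have := scale _ u0 us; rewrite A0.
have [w wA wmin] : exists2 w, w \in A & forall t, t \in A ->
    \sum_r c r * w 0 r ^+ 2 <= \sum_r c r * t 0 r ^+ 2.
  apply: (@EVT_min_rV _ _ (fun t => \sum_r c r * t 0 r ^+ 2)) => //.
    by exists v0.
  apply: continuous_subspaceT; apply: continuous_sum => r.
  exact: csq.
have wA' := set_mem wA; case: wA' => /= w0 w1.
exists (\sum_r c r * w 0 r ^+ 2).
  apply: cpos => //; rewrite -sumsq_eq0 w1; exact: oner_neq0.
move=> u us; have [->|u0] := eqVneq u 0.
  by rewrite c0 s0 mulr0.
have := wmin _ (mem_set (scale _ u0 us)).
under [leRHS]eq_bigr do rewrite mxE exprMn mulrCA.
rewrite -mulr_sumr exprVn sqr_sqrtr ?sumr_ge0// => [|r _]; last exact: sqr_ge0.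
rewrite ler_pdivlMl 1?mulrC// lt_def sumsq_eq0 u0/= sumr_ge0// => r _.
exact: sqr_ge0.
Qed.

Lemma xlnx_le_sqrt (R : realType) (x : R) : x <= 1 -> `|x * ln x| <= 2 * Num.sqrt x.
Proof.
move=> x1; have [x0|x0] := leP x 0.
  by rewrite ln0// mulr0 normr0 mulr_ge0// sqrtr_ge0.
have s0 : 0 < Num.sqrt x by rewrite sqrtr_gt0.
have sx : Num.sqrt x ^+ 2 = x by rewrite sqr_sqrtr// ltW.
have E : ln x = - 2 * ln (Num.sqrt x)^-1.
  by rewrite lnV ?posrE// -{1}sx lnXn// mulr2n; ring.
have h := @ln_sublinear R _ (divr_gt0 ltr01 s0); rewrite div1r in h.
have lx : ln x <= 0 by exact: ln_le0.
rewrite normrM (gtr0_norm x0) (ler0_norm lx) E.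
have -> : 2 * Num.sqrt x = x * (2 * (Num.sqrt x)^-1).
  by rewrite -{2}sx; field; rewrite gt_eqF.
by rewrite ler_pM2l//; lra.
Qed.

Lemma continuous_xlnx (R : realType) : continuous (fun x : R => x * ln x).
Proof.
move=> x; have [x0|x0|->] := ltgtP x 0.
- rewrite /continuous_at (ln0 (ltW x0)) mulr0.
  apply: cvg_near_cst; near=> y; rewrite ln0 ?mulr0//.
  apply: ltW; near: y; exact: lt_nbhsl.
- apply: cvgM; [exact: cvg_id|exact: continuous_ln].
rewrite /continuous_at mul0r.
apply/cvgr0Pnorm_le => e e0.
have cs : (fun y : R => 2 * Num.sqrt y) y @[y --> (0 : R)] --> (0 : R).
  rewrite -[X in _ --> X](mulr0 2) -[in X in _ --> X](@sqrtr0 R).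
  by apply: cvgM; [exact: cvg_cst|exact: sqrt_continuous].
have /cvgr0Pnorm_le/(_ e e0) h := cs.
near=> y.
apply: (@le_trans _ _ (2 * Num.sqrt y)).
  apply: xlnx_le_sqrt; apply: ltW; near: y; exact: lt_nbhsl.
apply: le_trans (ler_norm _) _; near: y; exact: h.
Unshelve. all: by end_near. Qed.

Lemma continuous_cw_H (R : realType) (q : nat) (beta : R) (B : 'rV[R]_q.-1) :
  continuous (cw_H beta B).
Proof.
have -> : cw_H beta B = fun t => \sum_r cw_H_coord beta B r (t 0 r).
  by apply/funext => t; rewrite cw_H_sum.
apply: continuous_sum => r; apply: continuous_coord => x.
apply: (@cvgB _ R^o); last exact: continuous_xlnx.
apply: (@cvgD _ R^o); apply: cvgM; try exact: cvg_cst; last exact: cvg_id.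
exact: exprn_continuous.
Qed.

Lemma prob_simplex_coord (R : realType) (q : nat) (t : 'rV[R]_q) :
  (forall r, 0 <= t 0 r) -> \sum_r t 0 r = 1 -> prob_simplex R q t.
Proof.
move=> t0 t1; split=> // r; rewrite t0/= -t1 (bigD1 r)//= lerDl.
exact: sumr_ge0.
Qed.

Lemma KL_quadratic_local (R : realType) (q : nat) (eta : R) (t m : 'rV[R]_q) :
  0 < eta < 1 -> (forall r, 0 < m 0 r) -> (forall r, 0 <= t 0 r) ->
  \sum_r t 0 r = \sum_r m 0 r ->
  (forall r, t 0 r <= (1 + eta) * m 0 r) ->
  (1 - eta) / 2 * \sum_r (m 0 r)^-1 * (t 0 r - m 0 r) ^+ 2 <= KL_div t m.
Proof.
move=> eta01 m0 t0 tm1 tm.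
have -> : KL_div t m =
    \sum_r (t 0 r * (ln (t 0 r) - ln (m 0 r)) - (t 0 r - m 0 r)).
  by rewrite sumrB sumrB tm1 subrr subr0.
rewrite mulr_sumr; apply: ler_sum => r _.
have mr := m0 r.
have y0 : 0 <= t 0 r / m 0 r by rewrite divr_ge0// ltW.
have y1 : t 0 r / m 0 r <= 1 + eta by rewrite ler_pdivrMr.
have := @xlnx_ge_local R eta (t 0 r / m 0 r) eta01.
rewrite y0 y1 => /(_ isT) /(ler_wpM2l (ltW mr)).
have -> : m 0 r * ((1 - eta) / 2 * (t 0 r / m 0 r - 1) ^+ 2) =
    (1 - eta) / 2 * ((m 0 r)^-1 * (t 0 r - m 0 r) ^+ 2).
  by field; rewrite gt_eqF.
move=> /le_trans; apply.
have [tr0|tr0] := eqVneq (t 0 r) 0.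
  by rewrite tr0 !mul0r !sub0r !opprK mulr1.
have tr : 0 < t 0 r by rewrite lt_def tr0 t0.
rewrite ln_div ?posrE//.
have -> : forall l : R, m 0 r * (t 0 r / m 0 r * l - (t 0 r / m 0 r - 1)) =
   t 0 r * l - (t 0 r - m 0 r) by move=> l; field; rewrite gt_eqF.
exact: lexx.
Qed.

Lemma quad_form_hessian (R : realType) (q : nat) (beta : R) (m u : 'rV[R]_q) :
  (u *m cw_hessian beta m *m u^T) 0 0 =
  - \sum_r ((m 0 r)^-1 - beta) * u 0 r ^+ 2.
Proof.
rewrite /cw_hessian mul_mx_diag mxE -sumrN; apply: eq_bigr => r _.
by rewrite !mxE; ring.
Qed.

Lemma KL_quadratic (R : realType) (q : nat) (beta : R) (B : 'rV[R]_q.-1)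
    (m : 'rV[R]_q) : 0 < beta ->
  unique_global_maximizer (cw_H beta B) (prob_simplex R q) m ->
  (forall u : 'rV[R]_q, u != 0 -> \sum_(r < q) u 0 r = 0 ->
      (u *m cw_hessian beta m *m u^T) 0 0 < 0) ->
  exists2 delta : R, 0 < delta & forall t, prob_simplex R q t ->
    (beta + delta) / 2 * \sum_r (t 0 r - m 0 r) ^+ 2 <= KL_div t m.
Proof.
move=> beta0 [mmax muniq] hess.
have [[m01 m1] _] := mmax.
have [L hL] := maximizer_gibbs beta0 mmax.
have m0 r : 0 < m 0 r := (hL r).1.
have [k k0 hk] : exists2 k : R, 0 < k & forall u : 'rV[R]_q, \sum_r u 0 r = 0 ->
    k * \sum_r u 0 r ^+ 2 <= \sum_r ((m 0 r)^-1 - beta) * u 0 r ^+ 2.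
  apply: hessian_coercive => u u0 us.
  by have := hess _ u0 us; rewrite quad_form_hessian oppr_lt0.
pose P : R := 1 + \sum_r (m 0 r)^-1.
have mi0 r : 0 <= (m 0 r)^-1 by rewrite invr_ge0 ltW.
have P1 : 1 <= P by rewrite lerDl sumr_ge0.
have mP r : (m 0 r)^-1 <= P.
  rewrite /P (bigD1 r)//= addrCA lerDl addr_ge0// sumr_ge0//.
have P0 : 0 < P by lra.
pose eta := k / (2 * (P + k)).
have eta0 : 0 < eta by rewrite divr_gt0// mulr_gt0//; lra.
have etaE : eta * (2 * (P + k)) = k by rewrite divfK// gt_eqF// mulr_gt0//; lra.
have eta1 : eta < 1 by nra.
have etaP : eta * P <= k / 2 by nra.
pose rho := (eta / P) ^+ 2.
have rho0 : 0 < rho by rewrite exprn_gt0// divr_gt0.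
pose S (t : 'rV[R]_q) := \sum_r (t 0 r - m 0 r) ^+ 2.
have S0 t : 0 <= S t by apply: sumr_ge0 => r _; exact: sqr_ge0.
have near_m t : prob_simplex R q t -> S t < rho ->
    (beta + k / 2) / 2 * S t <= KL_div t m.
  move=> [t01 t1] tS.
  have tr0 r : 0 <= t 0 r by have /andP[] := t01 r.
  have eta01 : 0 < eta < 1 by rewrite eta0.
  have small r : t 0 r <= (1 + eta) * m 0 r.
    have : (t 0 r - m 0 r) ^+ 2 <= (eta / P) ^+ 2.
      apply: le_trans (ltW tS).
      exact: (sumsq_ge (fun i => t 0 i - m 0 i)).
    rewrite -ler_sqrt ?sqr_ge0// !sqrtr_sqr (gtr0_norm (divr_gt0 eta0 P0)).
    move=> /(le_trans (ler_norm _)).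
    have : eta / P <= eta * m 0 r.
      rewrite ler_wpM2l ?(ltW eta0)//.
      by rewrite -[leRHS]invrK lef_pV2 ?posrE ?invr_gt0 ?m0.
    lra.
  have tm1 : \sum_r t 0 r = \sum_r m 0 r by rewrite t1 m1.
  apply: le_trans (KL_quadratic_local eta01 m0 tr0 tm1 small).
  set Q := \sum_r _ * _.
  have QP : Q <= P * S t.
    by rewrite /S mulr_sumr; apply: ler_sum => r _; rewrite ler_wpM2r ?sqr_ge0.
  have Qk : k * S t <= Q - beta * S t.
    have -> : Q - beta * S t =
        \sum_r ((m 0 r)^-1 - beta) * (t 0 r - m 0 r) ^+ 2.
      rewrite /Q /S [beta * _]mulr_sumr -sumrB.
      by apply: eq_bigr => r _; rewrite mulrBl.
    have tmE r : (t - m) 0 r = t 0 r - m 0 r by rewrite !mxE.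
    have := hk (t - m).
    under eq_bigr do rewrite tmE.
    rewrite sumrB t1 m1 subrr => /(_ erefl).
    under eq_bigr do rewrite tmE.
    by under [leRHS]eq_bigr do rewrite tmE.
  have := S0 t => St0.
  have h1 : eta * Q <= eta * (P * S t) by rewrite ler_pM2l.
  have h2 : eta * P * S t <= k / 2 * S t by rewrite ler_wpM2r.
  lra.
pose A := [set t : 'rV[R]_q | prob_simplex R q t] `&` [set t | rho <= S t].
have cS : continuous S.
  apply: continuous_sum => r.
  apply: (@continuous_coord _ _ r (fun x => (x - m 0 r) ^+ 2)).
  under eq_fun do rewrite -[_ ^+ 2]mul1r.
  exact: continuous_scaled_sqr.
have Sq t : prob_simplex R q t -> S t <= q%:R + 1.
  move=> [t01 _]; apply: (@le_trans _ _ (\sum_(r < q) 1)); last first.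
    by rewrite sumr_const card_ord lerDl.
  apply: ler_sum => r _.
  have /andP[a1 a2] := t01 r; have /andP[b1 b2] := m01 r; nra.
have cA : compact A.
  apply: (subclosed_compact _ (@compact_rV_box R q 1)); last first.
    move=> t [[t01 _] _] r; have /andP[t0 t1] := t01 r.
    by rewrite ger0_norm.
  apply: closedI; last exact: closed_ge_continuous.
  have -> : [set t | prob_simplex R q t] = [set t : 'rV[R]_q | \sum_r t 0 r = 1] `&`
      \bigcap_(r in [set: 'I_q]) [set t : 'rV[R]_q | 0 <= t 0 r].
    apply/seteqP; split => t /=.
      by move=> [t01 t1]; split=> // r _; have /andP[] := t01 r.
    by move=> [t1 t0]; apply: prob_simplex_coord => // r; exact: t0.
  apply: closedI.
    apply: closed_eq_continuous; apply: continuous_sum => r.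
    exact: coord_continuous.
  apply: closed_bigI => r _; apply: closed_ge_continuous.
  exact: coord_continuous.
have [[v0 Av0]|/set0P/negP/negPn/eqP A0] := pselect (A !=set0); last first.
  exists (k / 2); first by rewrite divr_gt0.
  move=> t tS; have [/near_m|h] := ltP (S t) rho; first exact.
  by have : A t by []; rewrite A0.
have [w wA wmax] : exists2 w, w \in A & forall t, t \in A ->
    cw_H beta B t <= cw_H beta B w.
  apply: EVT_max_rV => //; first by exists v0.
  by apply: continuous_subspaceT; exact: continuous_cw_H.
have [wS wrho] := set_mem wA.
pose mu := cw_H beta B m - cw_H beta B w.
have mu0 : 0 < mu.
  rewrite subr_gt0 ltNge; apply/negP => Hmw.
  have wm : w = m.
    apply: muniq; split => // t tS; exact: le_trans (mmax.2 _ tS) Hmw.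
  have : rho <= 0.
    by rewrite (le_trans wrho)// wm /S big1// => r _; rewrite subrr expr0n.
  by rewrite leNgt rho0.
have q0 : 0 < q%:R + 1 :> R by rewrite ltr_wpDl.
exists (Num.min (k / 2) (2 * (mu / (q%:R + 1)))).
  by rewrite lt_min !divr_gt0// mulr_gt0// divr_gt0.
move=> t tS; have [/(near_m _ tS)|h] := ltP (S t) rho.
  apply: le_trans; apply: ler_wpM2r; first exact: S0.
  have : Num.min (k / 2) (2 * (mu / (q%:R + 1))) <= k / 2.
    by rewrite ge_min lexx.
  lra.
have tA : t \in A by apply/mem_set.
have Htw := wmax _ tA.
have := cw_H_KL beta0 mmax tS.2; rewrite -/(S t) => E.
apply: (@le_trans _ _ (beta / 2 * S t + mu / (q%:R + 1) * S t)).
  rewrite -mulrDl; apply: ler_wpM2r; first exact: S0.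
  have : Num.min (k / 2) (2 * (mu / (q%:R + 1))) <= 2 * (mu / (q%:R + 1)).
    by rewrite ge_min lexx orbT.
  lra.
have : mu / (q%:R + 1) * S t <= mu.
  by rewrite mulrAC ler_pdivrMr// ler_pM2l// Sq.
rewrite /mu in Htw *; lra.
Qed.

(* The tilted law [t r = m r * exp (s r) / S] attains the entropy duality
   [ln S = sum_r t r * s r - KL t m], which turns a lower bound on KL into an
   upper bound on the moment generating function. *)
Lemma mgf_le (R : realType) (q : nat) (b : R) (m : 'rV[R]_q) (s : 'I_q -> R) :
  0 < b -> (forall r, 0 < m 0 r) -> \sum_r m 0 r = 1 ->
  (forall t, prob_simplex R q t ->
    b / 2 * \sum_r (t 0 r - m 0 r) ^+ 2 <= KL_div t m) ->
  \sum_r m 0 r * expR (s r) <=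
  expR (\sum_r s r * m 0 r + \sum_r s r ^+ 2 / (2 * b)).
Proof.
move=> b0 m0 m1 hKL.
set S := \sum_r m 0 r * expR (s r).
have a0 r : 0 < m 0 r * expR (s r) by rewrite mulr_gt0// expR_gt0.
have S0 : 0 < S.
  rewrite lt_def; apply/andP; split; last by apply: sumr_ge0 => r _; exact: ltW.
  apply/eqP => S0; have := oner_neq0 R; rewrite -m1 big1 ?eqxx// => r _.
  have := psumr_eq0P (fun i _ => ltW (a0 i)) S0 (i := r) isT.
  by move=> h; have := a0 r; rewrite h ltxx.
pose t := \row_r (m 0 r * expR (s r) / S) : 'rV[R]_q.
have t0 r : 0 < t 0 r by rewrite mxE divr_gt0.
have t1 : \sum_r t 0 r = 1.
  under eq_bigr do rewrite mxE.
  by rewrite -mulr_suml divff// gt_eqF.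
have tS : prob_simplex R q t by apply: prob_simplex_coord => // r; exact: ltW.
have KLE : KL_div t m = \sum_r t 0 r * s r - ln S.
  rewrite -[ln S]mul1r -t1 mulr_suml -sumrB; apply: eq_bigr => r _.
  rewrite -mulrBr; congr (_ * _).
  by rewrite mxE ln_div ?posrE// lnM ?posrE ?expR_gt0// expRK; ring.
rewrite -[leLHS]lnK ?posrE// ler_expR.
have := hKL t tS; rewrite KLE => h.
rewrite -big_split/=.
apply: (@le_trans _ _ (\sum_r (t 0 r * s r - b / 2 * (t 0 r - m 0 r) ^+ 2))).
  by rewrite sumrB -mulr_sumr; lra.
apply: ler_sum => r _.
rewrite -subr_ge0.
have -> : s r * m 0 r + s r ^+ 2 / (2 * b)
    - (t 0 r * s r - b / 2 * (t 0 r - m 0 r) ^+ 2) =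
    (s r - b * (t 0 r - m 0 r)) ^+ 2 / (2 * b).
  by field; rewrite gt_eqF.
by rewrite divr_ge0 ?sqr_ge0// mulr_ge0// ltW.
Qed.

Definition fluct {R : realType} (q N : nat) (m : 'rV[R]_q)
    (x : {ffun 'I_N -> 'I_q}) : 'rV[R]_q :=
  Num.sqrt N%:R *: (prop_vec x - m).

Definition iid_weight {R : realType} (q N : nat) (m : 'rV[R]_q)
    (x : {ffun 'I_N -> 'I_q}) : R := \prod_i m 0 (x i).

Lemma sum_prop_vec (R : realType) (q N : nat) (x : {ffun 'I_N -> 'I_q})
    (s : 'I_q -> R) :
  \sum_r s r * prop_vec x 0 r = N%:R^-1 * \sum_i s (x i).
Proof.
under eq_bigr do rewrite mxE mulrCA mulr_sumr.
rewrite -mulr_sumr exchange_big/=; congr (_ * _); apply: eq_bigr => i _.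
rewrite (bigD1 (x i))//= eqxx mulr1 big1 ?addr0// => r rx.
by rewrite eq_sym (negbTE rx) mulr0.
Qed.

Lemma sum_iid_weight (R : realType) (q N : nat) (m : 'rV[R]_q) :
  \sum_r m 0 r = 1 ->
  \sum_(x : {ffun 'I_N -> 'I_q}) iid_weight m x = 1.
Proof.
move=> m1.
rewrite -(bigA_distr_bigA (fun (_ : 'I_N) r => m 0 r)).
by rewrite big1.
Qed.

Lemma iid_mgf_le (R : realType) (q N : nat) (b : R) (m : 'rV[R]_q)
    (s : 'I_q -> R) :
  0 < b -> (0 < N)%N -> (forall r, 0 < m 0 r) -> \sum_r m 0 r = 1 ->
  (forall t, prob_simplex R q t ->
    b / 2 * \sum_r (t 0 r - m 0 r) ^+ 2 <= KL_div t m) ->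
  \sum_(x : {ffun 'I_N -> 'I_q})
    iid_weight m x * expR (\sum_r s r * fluct m x 0 r) <=
  expR (\sum_r s r ^+ 2 / (2 * b)).
Proof.
move=> b0 N0 m0 m1 hKL.
have NR0 : 0 < N%:R :> R by rewrite ltr0n.
set w := Num.sqrt (N%:R : R).
have w0 : 0 < w by rewrite sqrtr_gt0.
have wN : N%:R = w ^+ 2 by rewrite sqr_sqrtr// ltW.
pose sg r := s r / w.
pose c := \sum_r sg r * m 0 r.
have E (x : {ffun 'I_N -> 'I_q}) :
    iid_weight m x * expR (\sum_r s r * fluct m x 0 r) =
    \prod_i (m 0 (x i) * expR (sg (x i) - c)).
  rewrite big_split/=; congr (_ * _); rewrite -expR_sum; congr expR.
  have -> : \sum_r s r * fluct m x 0 r =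
      w * \sum_r s r * prop_vec x 0 r - w * \sum_r s r * m 0 r.
    rewrite -mulrBr -sumrB mulr_sumr; apply: eq_bigr => r _.
    by rewrite /fluct !mxE -/w; ring.
  rewrite sum_prop_vec sumrB sumr_const card_ord -[c *+ N]mulr_natl.
  congr (_ - _).
    rewrite mulrA mulr_sumr; apply: eq_bigr => i _.
    by rewrite /sg wN; field; rewrite gt_eqF.
  rewrite wN /c !mulr_sumr; apply: eq_bigr => r _.
  by rewrite /sg; field; rewrite gt_eqF.
rewrite (eq_bigr _ (fun x _ => E x)).
rewrite -(bigA_distr_bigA (fun (_ : 'I_N) r => m 0 r * expR (sg r - c))).
rewrite prodr_const card_ord.
have h : \sum_r m 0 r * expR (sg r - c) <= expR (\sum_r sg r ^+ 2 / (2 * b)).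
  have -> : \sum_r m 0 r * expR (sg r - c) =
      (\sum_r m 0 r * expR (sg r)) * expR (- c).
    by rewrite mulr_suml; apply: eq_bigr => r _; rewrite expRD mulrA.
  rewrite -ler_pdivlMr ?expR_gt0// -expRN opprK -expRD addrC.
  exact: mgf_le.
apply: le_trans (lerXn2r _ _ _ h) _.
- by rewrite nnegrE sumr_ge0// => r _; rewrite mulr_ge0 ?expR_ge0// ltW.
- by rewrite nnegrE expR_ge0.
rewrite -expRM_natl ler_expR wN mulr_sumr.
by apply: ler_sum => r _; rewrite /sg le_eqVlt; apply/orP; left; apply/eqP;
  field; rewrite !gt_eqF.
Qed.

Definition signed_nat {R : realType} (M : nat) (p : bool * 'I_M) : R :=
  (-1) ^+ p.1 * p.2%:R.

(* Only one term of the sum is used: the integer part of x towards 0. *)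
Lemma discrete_hubbard_stratonovich (R : realType) (b x : R) (M : nat) :
  0 <= b -> `|x| < M%:R ->
  expR (b / 2 * x ^+ 2) <= expR (b / 2) *
    \sum_(p : bool * 'I_M) expR (b * (signed_nat p * x - signed_nat p ^+ 2 / 2)).
Proof.
move=> b0 xM.
have [k1 k2] : (Num.truncn `|x|)%:R <= `|x| /\ `|x| < (Num.truncn `|x|).+1%:R.
  by have /andP := truncn_itv (normr_ge0 x).
have kM : (Num.truncn `|x| < M)%N by rewrite -(ltr_nat R) (le_lt_trans k1).
pose p : bool * 'I_M := (x < 0, Ordinal kM).
rewrite (bigD1 p)//= mulrDr ler_wpDr//.
  by rewrite mulr_ge0 ?expR_ge0// sumr_ge0// => ? _; rewrite expR_ge0.
rewrite -expRD ler_expR /signed_nat /=.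
set k := (Num.truncn `|x|)%:R in k1 *.
have k2' : `|x| < k + 1 by rewrite /k natr1.
have -> : (-1) ^+ (x < 0)%R * k * x = k * `|x|.
  by rewrite mulrAC -normrEsign mulrC.
rewrite exprMn sqrr_sign mul1r -[x ^+ 2]real_normK ?num_real//.
have : b * (`|x| - k) ^+ 2 <= b * 1.
  apply: ler_wpM2l => //; nra.
lra.
Qed.

Lemma sum_signed_nat_le (R : realType) (c : R) (M : nat) : 0 < c ->
  \sum_(p : bool * 'I_M) expR (- c * signed_nat p ^+ 2) <=
  2 * (1 - expR (- c))^-1.
Proof.
move=> c0.
set rho := expR (- c).
have rho1 : rho < 1 by rewrite expR_lt1; lra.
have rho0 : 0 < rho by exact: expR_gt0.
have geo : \sum_(k < M) rho ^+ k <= (1 - rho)^-1.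
  rewrite -[leRHS]mul1r ler_pdivlMr ?subr_gt0//.
  have -> : (\sum_(k < M) rho ^+ k) * (1 - rho) = 1 - rho ^+ M.
    by rewrite -[RHS]opprB subrX1; ring.
  by rewrite gerBl exprn_ge0// ltW.
have sq (k : nat) : k%:R <= k%:R ^+ 2 :> R.
  by rewrite -natrX ler_nat; case: k => // k; rewrite leq_pmulr.
rewrite -(pair_big_dep xpredT (fun=> xpredT)
   (fun (e : bool) (k : 'I_M) => expR (- c * signed_nat (e, k) ^+ 2)))/=.
rewrite big_bool/= mulr_natl mulr2n; apply: lerD; apply: le_trans geo;
  apply: ler_sum => k _; rewrite /signed_nat exprMn sqrr_sign mul1r /rho -expRM_natl;
  rewrite ler_expR mulrC; have := sq k; nra.
Qed.

Lemma iid_exp_moment (R : realType) (q : nat) (b b' : R) (m : 'rV[R]_q) :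
  0 < b' < b -> (forall r, 0 < m 0 r) -> \sum_r m 0 r = 1 ->
  (forall t, prob_simplex R q t ->
    b / 2 * \sum_r (t 0 r - m 0 r) ^+ 2 <= KL_div t m) ->
  exists C : R, forall N, (0 < N)%N ->
  \sum_(x : {ffun 'I_N -> 'I_q})
    iid_weight m x * expR (b' / 2 * \sum_r fluct m x 0 r ^+ 2) <= C.
Proof.
move=> /andP[b'0 b'b] m0 m1 hKL.
have b0 : 0 < b by lra.
pose c := b' / 2 * (1 - b' / b).
have c0 : 0 < c.
  by rewrite mulr_gt0 ?divr_gt0// subr_gt0 ltr_pdivrMr// mul1r.
exists ((expR (b' / 2) * (2 * (1 - expR (- c))^-1)) ^+ q) => N N0.
pose M := (Num.truncn (\sum_(x : {ffun 'I_N -> 'I_q}) \sum_r `|fluct m x 0 r|)).+1.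
have xM (x : {ffun 'I_N -> 'I_q}) r : `|fluct m x 0 r| < M%:R.
  apply: le_lt_trans (truncnS_gt _).
  rewrite (bigD1 x)//= (bigD1 r)//= -addrA lerDl addr_ge0// sumr_ge0// => ? _.
  exact: sumr_ge0.
pose K (p : bool * 'I_M) : R := signed_nat p.
have hs (x : {ffun 'I_N -> 'I_q}) : expR (b' / 2 * \sum_r fluct m x 0 r ^+ 2) <=
    expR (b' / 2) ^+ q * \sum_(g : {ffun 'I_q -> bool * 'I_M})
      expR (\sum_r (b' * K (g r)) * fluct m x 0 r)
      * expR (\sum_r - (b' / 2) * K (g r) ^+ 2).
  rewrite mulr_sumr expR_sum.
  apply: (@le_trans _ _ (\prod_(r < q) (expR (b' / 2) * \sum_(p : bool * 'I_M)
      expR (b' * (K p * fluct m x 0 r - K p ^+ 2 / 2))))).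
    apply: ler_prod => r _; rewrite expR_ge0/=.
    by apply: discrete_hubbard_stratonovich; [exact: ltW|exact: xM].
  rewrite big_split/= prodr_const card_ord bigA_distr_bigA/=.
  apply: ler_wpM2l; first by rewrite exprn_ge0// expR_ge0.
  rewrite le_eqVlt; apply/orP; left; apply/eqP; apply: eq_bigr => g _.
  by rewrite -expRD -big_split/= expR_sum; apply: eq_bigr => r _;
    congr expR; field.
apply: (@le_trans _ _ (expR (b' / 2) ^+ q *
    \sum_(g : {ffun 'I_q -> bool * 'I_M})
      expR (\sum_r (b' * K (g r)) ^+ 2 / (2 * b)) *
      expR (\sum_r - (b' / 2) * K (g r) ^+ 2))).
  apply: (@le_trans _ _ (\sum_(x : {ffun 'I_N -> 'I_q}) iid_weight m x *
     (expR (b' / 2) ^+ q * \sum_(g : {ffun 'I_q -> bool * 'I_M})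
      expR (\sum_r (b' * K (g r)) * fluct m x 0 r)
      * expR (\sum_r - (b' / 2) * K (g r) ^+ 2)))).
    apply: ler_sum => x _; apply: ler_wpM2l; last exact: hs.
    by apply: prodr_ge0 => i _; exact: ltW.
  under eq_bigr do rewrite mulrCA mulr_sumr.
  rewrite -mulr_sumr exchange_big/=.
  apply: ler_wpM2l; first by rewrite exprn_ge0// expR_ge0.
  apply: ler_sum => g _.
  under eq_bigr do rewrite mulrA.
  rewrite -mulr_suml; apply: ler_wpM2r; first exact: expR_ge0.
  exact: iid_mgf_le.
rewrite exprMn; apply: ler_wpM2l; first by rewrite exprn_ge0// expR_ge0.
have -> : \sum_(g : {ffun 'I_q -> bool * 'I_M})
      expR (\sum_r (b' * K (g r)) ^+ 2 / (2 * b)) *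
      expR (\sum_r - (b' / 2) * K (g r) ^+ 2) =
    \sum_(g : {ffun 'I_q -> bool * 'I_M}) \prod_r expR (- c * K (g r) ^+ 2).
  apply: eq_bigr => g _; rewrite -expRD -big_split/= expR_sum.
  by apply: eq_bigr => r _; congr expR; rewrite /c; field; rewrite gt_eqF.
rewrite -(bigA_distr_bigA (fun (_ : 'I_q) p => expR (- c * K p ^+ 2))).
rewrite prodr_const card_ord; apply: lerXn2r; last exact: sum_signed_nat_le.
  by rewrite nnegrE sumr_ge0// => ? _; exact: expR_ge0.
by rewrite nnegrE mulr_ge0// invr_ge0 subr_ge0 expR_le1; lra.
Qed.

Lemma cw_weight_gibbs (R : realType) (q N : nat) (beta : R) (B : 'rV[R]_q.-1)
    (m : 'rV[R]_q) (L : R) (x : {ffun 'I_N -> 'I_q}) :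
  (0 < N)%N ->
  (forall r, 0 < m 0 r /\ ln (m 0 r) = beta * m 0 r + field_ext B r - L) ->
  cw_weight beta B x =
  expR (N%:R * (L - beta / 2 * \sum_r m 0 r ^+ 2)) *
  (iid_weight m x * expR (beta / 2 * \sum_r fluct m x 0 r ^+ 2)).
Proof.
move=> N0 hL.
have NR0 : N%:R != 0 :> R by rewrite pnatr_eq0 -lt0n.
have -> : iid_weight m x = expR (N%:R * \sum_r ln (m 0 r) * prop_vec x 0 r).
  rewrite (sum_prop_vec x (fun r => ln (m 0 r))) mulrA divff// mul1r expR_sum.
  by apply: eq_bigr => i _; rewrite lnK// posrE; have [] := hL (x i).
have x1 : \sum_r prop_vec x 0 r = 1 :> R.
  have := @sum_prop_vec R q N x (fun=> 1).
  under eq_bigr do rewrite mul1r.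
  by move=> ->; rewrite sumr_const card_ord -[1 *+ N]/(N%:R) mulVf.
rewrite /cw_weight -!expRD; congr expR.
have -> : \sum_r fluct m x 0 r ^+ 2 =
    N%:R * \sum_r (prop_vec x 0 r - m 0 r) ^+ 2.
  rewrite mulr_sumr; apply: eq_bigr => r _.
  rewrite /fluct mxE exprMn sqr_sqrtr ?ler0n//; congr (_ * _ ^+ 2).
  by rewrite !mxE.
have -> : L = \sum_r L * prop_vec x 0 r by rewrite -mulr_sumr x1 mulr1.
rewrite !(mulr_sumr, mulrBr, mulrDr) -!(sumrB, big_split)/= .
by apply: eq_bigr => r _; rewrite (hL r).2; field.
Qed.

Lemma cw_pmf_ge0 (R : realType) (q N : nat) (beta : R) (B : 'rV[R]_q.-1)
  (x : {ffun 'I_N -> 'I_q}) : 0 <= cw_pmf beta B x.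
Proof.
by rewrite mulr_ge0 ?expR_ge0// invr_ge0 sumr_ge0// => y _; exact: expR_ge0.
Qed.

Lemma cw_exp_moment (R : realType) (q : nat) (beta : R) (B : 'rV[R]_q.-1)
    (m : 'rV[R]_q) : 0 < beta ->
  unique_global_maximizer (cw_H beta B) (prob_simplex R q) m ->
  (forall u : 'rV[R]_q, u != 0 -> \sum_(r < q) u 0 r = 0 ->
      (u *m cw_hessian beta m *m u^T) 0 0 < 0) ->
  exists c C : R, 0 < c /\ forall N, (0 < N)%N ->
    \sum_(x : {ffun 'I_N -> 'I_q})
      cw_pmf beta B x * expR (c * \sum_r fluct m x 0 r ^+ 2) <= C.
Proof.
move=> beta0 hmax hhess.
have [delta delta0 hKL] := KL_quadratic beta0 hmax hhess.
have [L hL] := maximizer_gibbs beta0 hmax.1.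
have m0 r : 0 < m 0 r by have [] := hL r.
have m1 : \sum_r m 0 r = 1 := hmax.1.1.2.
have bb : 0 < beta + delta / 2 < beta + delta by apply/andP; split; lra.
have [C hC] := iid_exp_moment bb m0 m1 hKL.
exists (delta / 4), C; split; first by rewrite divr_gt0.
move=> N N0; have CN := hC N N0.
have iw0 (x : {ffun 'I_N -> 'I_q}) : 0 <= iid_weight m x.
  by apply: prodr_ge0 => i _; exact: ltW.
have C0 : 0 <= C.
  apply: le_trans CN; apply: sumr_ge0 => x _.
  by rewrite mulr_ge0// expR_ge0.
set A := N%:R * (L - beta / 2 * \sum_r m 0 r ^+ 2).
have ZA : expR A <= cw_partition beta B N.
  rewrite -[leLHS]mulr1 -(sum_iid_weight N m1) mulr_sumr.
  apply: ler_sum => x _; rewrite (cw_weight_gibbs _ N0 hL) -/A.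
  apply: ler_wpM2l; first exact: expR_ge0.
  rewrite ler_peMr// -expR0 ler_expR mulr_ge0//; first by rewrite divr_ge0// ltW.
  by apply: sumr_ge0 => r _; exact: sqr_ge0.
have Z0 : 0 < cw_partition beta B N by apply: lt_le_trans ZA; exact: expR_gt0.
have -> : \sum_(x : {ffun 'I_N -> 'I_q})
      cw_pmf beta B x * expR (delta / 4 * \sum_r fluct m x 0 r ^+ 2) =
    (cw_partition beta B N)^-1 * \sum_(x : {ffun 'I_N -> 'I_q})
      cw_weight beta B x * expR (delta / 4 * \sum_r fluct m x 0 r ^+ 2).
  by rewrite mulr_sumr; apply: eq_bigr => x _; rewrite mulrA.
rewrite ler_pdivrMl//.
apply: (@le_trans _ _ (expR A * C)); last by rewrite ler_wpM2r.
apply: (@le_trans _ _ (expR A * \sum_(x : {ffun 'I_N -> 'I_q})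
    iid_weight m x * expR ((beta + delta / 2) / 2 * \sum_r fluct m x 0 r ^+ 2))).
  rewrite mulr_sumr; apply: ler_sum => x _.
  rewrite (cw_weight_gibbs _ N0 hL) -/A.
  set F := \sum_r fluct m x 0 r ^+ 2.
  have -> : (beta + delta / 2) / 2 * F = beta / 2 * F + delta / 4 * F by field.
  by rewrite expRD !mulrA.
by apply: ler_wpM2l; first exact: expR_ge0.
Qed.

Lemma expR_tail_small (R : realType) (c C eps : R) : 0 < c -> 0 < eps ->
  exists2 M0 : R, 0 <= M0 & forall M, M0 <= M -> C * expR (- c * M ^+ 2) <= eps.
Proof.
move=> c0 e0; exists (1 + `|C| / (c * eps)).
  by rewrite addr_ge0// divr_ge0// mulr_ge0// ltW.
move=> M hM.
have ce : 0 < c * eps by exact: mulr_gt0.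
have q0 : 0 <= `|C| / (c * eps) by rewrite divr_ge0// ltW.
have M1 : 1 <= M by lra.
have hC : `|C| <= M * (c * eps) by rewrite -ler_pdivrMr//; lra.
have cM : 0 < c * M ^+ 2 by rewrite mulr_gt0// exprn_gt0//; lra.
apply: (@le_trans _ _ (`|C| * expR (- c * M ^+ 2))).
  by rewrite ler_wpM2r ?expR_ge0// ler_norm.
rewrite mulNr expRN ler_pdivrMr ?expR_gt0//.
have := expR_ge1Dx (c * M ^+ 2) => h.
have : eps * (c * M ^+ 2) <= eps * expR (c * M ^+ 2).
  by rewrite ler_pM2l//; lra.
have : M * (c * eps) <= eps * (c * M ^+ 2).
  have : 0 <= (M - 1) * (M * (c * eps)) by rewrite mulr_ge0 ?mulr_ge0//; lra.
  lra.
lra.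
Qed.

Lemma measurable_dist_gt (R : realType) (a c M : R) :
  measurable [set z : R | M < `|c * (z - a)|].
Proof.
have mf : measurable_fun setT (fun z : R => `|c * (z - a)|).
  apply: measurableT_comp => //; apply: measurable_funM => //.
  exact: measurable_funB.
have := mf measurableT _ (measurable_itv `]M, +oo[).
rewrite setTI; congr measurable.
by apply/seteqP; split => z /=; rewrite in_itv/= andbT.
Qed.

(* Doubling the variance turns the tail of the density into a uniform factor. *)
Lemma normal_prob_tail (R : realType) (a s M c : R) : 0 < s -> 0 <= M ->
  (normal_prob a s [set z : R | (M < `|c * (z - a)|)%R] <=
   (Num.sqrt 2 * expR (- (M ^+ 2 / (4 * (c * s) ^+ 2))))%:E)%E.
Proof.
move=> s0 M0.
have [->|c0] := eqVneq c 0.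
  have -> : [set z : R | M < `|0 * (z - a)|] = set0.
    apply/seteqP; split => z //=; rewrite mul0r normr0; lra.
  by rewrite measure0 lee_fin mulr_ge0 ?expR_ge0.
set V := [set z | _]; have mV : measurable V := measurable_dist_gt a c M.
pose s' := Num.sqrt 2 * s.
have r0 : 0 < Num.sqrt 2 :> R by rewrite sqrtr_gt0.
have s'0 : 0 < s' by rewrite mulr_gt0.
have sn0 : s != 0 by rewrite gt_eqF.
have s'n0 : s' != 0 by rewrite gt_eqF.
pose k := Num.sqrt 2 * expR (- (M ^+ 2 / (4 * (c * s) ^+ 2))).
have k0 : 0 <= k by rewrite mulr_ge0 ?expR_ge0.
have mpdf s1 : measurable_fun V (fun z => (normal_pdf a s1 z)%:E).
  apply: measurable_funTS; apply/measurable_EFinP; exact: measurable_normal_pdf.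
apply: (@le_trans _ _ (\int[lebesgue_measure]_(z in V)
  (k%:E * (normal_pdf a s' z)%:E))%E).
  apply: ge0_le_integral => //.
  - by move=> z _; rewrite lee_fin normal_pdf_ge0.
  - exact: mpdf.
  - exact: (measurable_funeM k%:E (mpdf _)).
  move=> z Vz; rewrite -EFinM lee_fin !normal_pdfE// /normal_fun.
  have s'E : s' ^+ 2 = 2 * s ^+ 2 by rewrite exprMn sqr_sqrtr.
  have -> : normal_peak s' = (Num.sqrt 2)^-1 * normal_peak s.
    rewrite /normal_peak s'E -invfM -sqrtrM//; congr (Num.sqrt _)^-1; ring.
  rewrite s'E /k [leRHS](_ : _ = normal_peak s *
     (expR (- (M ^+ 2 / (4 * (c * s) ^+ 2))) *
     expR (- (z - a) ^+ 2 / (2 * s ^+ 2 *+ 2)))); last first.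
    by field; rewrite gt_eqF.
  apply: ler_wpM2l; first exact: normal_peak_ge0.
  rewrite -expRD ler_expR.
  have : M ^+ 2 / (4 * (c * s) ^+ 2) <= (z - a) ^+ 2 / (4 * s ^+ 2).
    have h : M ^+ 2 <= c ^+ 2 * (z - a) ^+ 2.
      rewrite -exprMn -[leRHS]real_normK ?num_real//.
      by rewrite lerXn2r ?nnegrE// ltW.
    rewrite ler_pdivrMr; last by rewrite mulr_gt0// exprn_even_gt0//= mulf_neq0.
    rewrite [leRHS](_ : _ = c ^+ 2 * (z - a) ^+ 2)//.
    by field.
  have -> : - (z - a) ^+ 2 / (s ^+ 2 *+ 2) =
    - ((z - a) ^+ 2 / (4 * s ^+ 2)) - (z - a) ^+ 2 / (4 * s ^+ 2) by field.
  have -> : - (z - a) ^+ 2 / (2 * s ^+ 2 *+ 2) =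
    - ((z - a) ^+ 2 / (4 * s ^+ 2)) by field.
  lra.
rewrite ge0_integralZl//; last by move=> z _; rewrite lee_fin normal_pdf_ge0.
  rewrite -[leRHS]mule1; apply: lee_wpmul2l; first by rewrite lee_fin.
  exact: (@probability_le1 _ _ _ (normal_prob a s')).
exact: mpdf.
Qed.

Lemma measure_bigsetU_le (R : realType) d (T : measurableType d)
    (mu : {measure set T -> \bar R}) (I : Type) (s : seq I) (P : pred I)
    (F : I -> set T) :
  (forall i, P i -> measurable (F i)) ->
  (mu (\big[setU/set0]_(i <- s | P i) F i) <= \sum_(i <- s | P i) mu (F i))%E.
Proof.
move=> mF; elim: s => [|i s IH]; first by rewrite !big_nil measure0.
rewrite !big_cons; case: ifP => // Pi.
have mU : measurable (\big[setU/set0]_(j <- s | P j) F j).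
  exact: bigsetU_measurable.
apply: (le_trans (measureU2 mu (mF i Pi) mU)).
by rewrite leeD2l.
Qed.

Lemma bigsetUP (T : Type) (I : finType) (P : pred I) (F : I -> set T) (w : T) :
  (\big[setU/set0]_(i | P i) F i) w <-> exists2 i, P i & F i w.
Proof.
rewrite -bigcup_seq_cond; split => [[i /= /andP[_ Pi] Fi]|[i Pi Fi]].
  by exists i.
by exists i => //=; rewrite mem_index_enum.
Qed.

Lemma box_complement (R : realType) (q : nat) (M : R) (v : 'rV[R]_q) :
  (~` [set v : 'rV[R]_q | forall r, `|v 0 r| <= M]) v <->
  exists r, M < `|v 0 r|.
Proof.
split => /= [/existsNP[r /negP]|[r Mr] /(_ r)]; last by rewrite leNgt Mr.
by rewrite -ltNge => Mr; exists r.
Qed.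

Section sample.
Context (R : realType) (q N : nat) (beta : R) (B : 'rV[R]_q.-1) (m : 'rV[R]_q).
Context d (T : measurableType d) (P : probability T R).
Context (X : T -> {ffun 'I_N -> 'I_q}) (Z : 'I_q -> {RV P >-> R}).
Context (N0 : (0 < N)%N) (beta0 : 0 < beta).
Context (sample : cw_gaussian_sample beta B X Z).

Lemma fluct_tail (c C M : R) : 0 < c -> 0 <= M ->
  \sum_(x : {ffun 'I_N -> 'I_q})
      cw_pmf beta B x * expR (c * \sum_r fluct m x 0 r ^+ 2) <= C ->
  (P (X @^-1` [set x | exists r, (M < `|fluct m x 0 r|)%R]) <=
   (C * expR (- c * M ^+ 2))%:E)%E.
Proof.
move=> c0 M0 hC.
pose A (x : {ffun 'I_N -> 'I_q}) := [exists r, M < `|fluct m x 0 r|].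
have mX x : measurable (X @^-1` [set x]) by exact: (cw_sample_measurable sample).
have -> : X @^-1` [set x | exists r, (M < `|fluct m x 0 r|)%R] =
    \big[setU/set0]_(x | A x) (X @^-1` [set x]).
  apply/seteqP; split => w.
    by move=> /existsP h; apply/bigsetUP; exists (X w).
  by move=> /bigsetUP[x /existsP Ax /= ->].
apply: (le_trans (measure_bigsetU_le _ _ _)) => //.
have -> : (\sum_(x | A x) P (X @^-1` [set x]) = (\sum_(x | A x) cw_pmf beta B x)%:E)%E.
  by rewrite -sumEFin; apply: eq_bigr => x _; exact: (cw_sample_law sample).
rewrite lee_fin mulNr expRN ler_pdivlMr ?expR_gt0//; apply: le_trans hC.
rewrite mulr_suml [leLHS]big_mkcond; apply: ler_sum => x _.
case: ifPn => [/existsP[r Mr]|_]; last by rewrite mulr_ge0 ?cw_pmf_ge0 ?expR_ge0.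
apply: ler_wpM2l; first exact: cw_pmf_ge0.
rewrite ler_expR ler_pM2l//; apply: le_trans (sumsq_ge (fluct m x 0) r).
by rewrite -[leRHS]real_normK ?num_real// lerXn2r ?nnegrE// ltW.
Qed.

Lemma gaussian_noise_tail (r : 'I_q) (M : R) : 0 <= M ->
  (\sum_(x : {ffun 'I_N -> 'I_q})
    P (Z r @^-1` [set z | M < `|Num.sqrt N%:R * (z - prop_vec x 0 r)|]%R
       `&` X @^-1` [set x]) <=
   (Num.sqrt 2 * expR (- (beta / 4) * M ^+ 2))%:E)%E.
Proof.
move=> M0; set t := Num.sqrt 2 * _.
have t0 : 0 <= t by rewrite mulr_ge0 ?expR_ge0.
have NR0 : 0 < N%:R :> R by rewrite ltr0n.
have le x : (P (Z r @^-1` [set z | M < `|Num.sqrt N%:R * (z - prop_vec x 0 r)|]%R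
       `&` X @^-1` [set x]) <= (t * cw_pmf beta B x)%:E)%E.
  set D := [set z | _]; have mD : measurable D := measurable_dist_gt _ _ _.
  have mX : measurable (X @^-1` [set x]) by exact: (cw_sample_measurable sample).
  have mZ : measurable (Z r @^-1` D) by exact: measurable_funPTI.
  have := @normal_prob_tail R (prop_vec x 0 r) (Num.sqrt (beta * N%:R)^-1) M
    (Num.sqrt N%:R).
  rewrite sqrtr_gt0 invr_gt0 mulr_gt0// M0 => /(_ isT isT).
  rewrite -(cw_sample_cond_normal sample x r mD) lee_fin /cond_prob.
  rewrite (cw_sample_law sample) /=.
  have p0 : 0 < cw_pmf beta B x.
    rewrite mulr_gt0 ?expR_gt0// invr_gt0 /cw_partition (bigD1 x)//=.
    by rewrite ltr_pwDl ?expR_gt0// sumr_ge0// => y _; exact: expR_ge0.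
  have -> : M ^+ 2 / (4 * (Num.sqrt N%:R * Num.sqrt (beta * N%:R)^-1) ^+ 2) =
      beta / 4 * M ^+ 2.
    rewrite exprMn !sqr_sqrtr ?ler0n// ?invr_ge0 ?mulr_ge0 ?ler0n ?(ltW beta0)//.
    by field; rewrite !gt_eqF.
  rewrite -mulNr -/t ler_pdivrMr// -lee_fin fineK//.
  by apply: fin_num_measure; exact: measurableI.
apply: (le_trans (lee_sum _ (fun x _ => le x))).
rewrite sumEFin lee_fin -mulr_sumr ler_piMr//.
rewrite -mulr_sumr -/(cw_partition beta B N).
by have [->|Z0] := eqVneq (cw_partition beta B N) 0; rewrite ?mulr0// mulVf.
Qed.

Lemma smoothed_fluct_tail (c C M : R) : 0 < c -> 0 <= M ->
  \sum_(x : {ffun 'I_N -> 'I_q})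
      cw_pmf beta B x * expR (c * \sum_r fluct m x 0 r ^+ 2) <= C ->
  (P [set w | exists r, (M + M < `|Num.sqrt N%:R * (Z r w - m 0 r)|)%R] <=
   (C * expR (- c * M ^+ 2) +
    q%:R * (Num.sqrt 2 * expR (- (beta / 4) * M ^+ 2)))%:E)%E.
Proof.
move=> c0 M0 hC.
pose F (r : 'I_q) (x : {ffun 'I_N -> 'I_q}) :=
  Z r @^-1` [set z | M < `|Num.sqrt N%:R * (z - prop_vec x 0 r)|]%R
       `&` X @^-1` [set x].
pose G := X @^-1` [set x | exists r, (M < `|fluct m x 0 r|)%R].
have mX A : measurable (X @^-1` A) by exact: (cw_sample_measurable sample).
have mF r x : measurable (F r x).
  apply: measurableI => //; apply: measurable_funPTI.
  exact: measurable_dist_gt.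
pose H r := \big[setU/set0]_x F r x.
have mH r : measurable (H r) by exact: bigsetU_measurable.
have mE : measurable [set w | exists r, (M + M < `|Num.sqrt N%:R * (Z r w - m 0 r)|)%R].
  rewrite (_ : [set w | _] = \big[setU/set0]_r
     (Z r @^-1` [set z | M + M < `|Num.sqrt N%:R * (z - m 0 r)|]%R)).
    apply: bigsetU_measurable => r _; apply: measurable_funPTI.
    exact: measurable_dist_gt.
  apply/seteqP; split => w /=.
    by move=> [r hr]; apply/bigsetUP; exists r.
  by move=> /bigsetUP[r _ hr]; exists r.
have mG : measurable G by exact: mX.
have mHs : measurable (\big[setU/set0]_r H r) by exact: bigsetU_measurable.
apply: (@le_trans _ _ (P (G `|` \big[setU/set0]_r H r))).
  apply: le_measure; rewrite ?inE//; first exact: measurableU.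
  move=> w /= [r hr].
  have [Mr|Mr] := ltP M `|fluct m (X w) 0 r|; first by left; exists r.
  right; apply/bigsetUP; exists r => //; apply/bigsetUP; exists (X w) => //.
  split => //=.
  have E : Num.sqrt N%:R * (Z r w - m 0 r) =
      Num.sqrt N%:R * (Z r w - prop_vec (X w) 0 r) + fluct m (X w) 0 r.
    by rewrite /fluct !mxE; ring.
  rewrite E in hr.
  have := ler_normD (Num.sqrt N%:R * (Z r w - prop_vec (X w) 0 r)) (fluct m (X w) 0 r).
  lra.
apply: (le_trans (measureU2 P mG mHs)).
rewrite EFinD; apply: leeD; first exact: fluct_tail.
apply: (le_trans (measure_bigsetU_le _ _ _)) => //.
apply: (@le_trans _ _ (\sum_(r < q)
   (Num.sqrt 2 * expR (- (beta / 4) * M ^+ 2))%:E)%E).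
  apply: lee_sum => r _.
  apply: (le_trans (measure_bigsetU_le _ _ _)) => //.
  exact: gaussian_noise_tail.
by rewrite sumEFin sumr_const card_ord mulr_natl.
Qed.

End sample.

Theorem lemmaH4 (R : realType) (q : nat) (hq : (2 <= q)%N)
    (beta : R) (hbeta : 0 < beta) (B : 'rV[R]_q.-1) (m : 'rV[R]_q)
    (hmax : unique_global_maximizer (cw_H beta B) (prob_simplex R q) m)
    (hhess : forall u : 'rV[R]_q, u != 0 -> \sum_(r < q) u 0 r = 0 ->
      (u *m cw_hessian beta m *m u^T) 0 0 < 0)
    (d : nat -> measure_display) (T : forall N, measurableType (d N))
    (P : forall N, probability (T N) R)
    (X : forall N, T N -> {ffun 'I_N -> 'I_q})
    (Z : forall N, 'I_q -> {RV (P N) >-> R})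
    (hsample : forall N, (0 < N)%N ->
      cw_gaussian_sample beta B (X N) (Z N)) :
  tight_seq P (fun N w =>
    Num.sqrt (N%:R : R) *: (prop_vec (X N w) - m)) /\
  tight_seq P (fun N w =>
    Num.sqrt (N%:R : R) *: (\row_r Z N r w - m)).
Proof.
have [c [C [c0 hC]]] := cw_exp_moment hbeta hmax hhess.
split=> eps e0.
  have [M M0 hM] := expR_tail_small C c0 e0.
  exists [set v | forall r, `|v 0 r| <= M]; split; first exact: compact_rV_box.
  move=> N N0.
  have -> : (fun w => Num.sqrt (N%:R : R) *: (prop_vec (X N w) - m)) @^-1`
      (~` [set v | forall r, `|v 0 r| <= M]) =
      X N @^-1` [set x | exists r, (M < `|fluct m x 0 r|)%R].
    by apply/seteqP; split => w /box_complement.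
  apply: (le_trans (fluct_tail (hsample _ N0) c0 M0 (hC _ N0))).
  by rewrite lee_fin hM.
have e20 : 0 < eps / 2 by rewrite divr_gt0.
have b40 : 0 < beta / 4 by rewrite divr_gt0.
have [M1 M10 hM1] := expR_tail_small C c0 e20.
have [M2 M20 hM2] := expR_tail_small (q%:R * Num.sqrt 2) b40 e20.
pose M := M1 + M2.
have M0 : 0 <= M by rewrite addr_ge0.
exists [set v | forall r, `|v 0 r| <= M + M]; split; first exact: compact_rV_box.
move=> N N0.
have -> : (fun w => Num.sqrt (N%:R : R) *: (\row_r Z N r w - m)) @^-1`
    (~` [set v | forall r, `|v 0 r| <= M + M]) =
    [set w | exists r, (M + M < `|Num.sqrt N%:R * (Z N r w - m 0 r)|)%R].
  apply/seteqP; split => w.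
    by move=> /box_complement[r]; rewrite !mxE => hr; exists r.
  by move=> [r hr]; apply/box_complement; exists r; rewrite !mxE.
apply: (le_trans (smoothed_fluct_tail N0 hbeta (hsample _ N0) c0 M0 (hC _ N0))).
rewrite lee_fin.
have h1 : M1 <= M by rewrite lerDl.
have h2 : M2 <= M by rewrite lerDr.
have := hM1 _ h1; have := hM2 _ h2; rewrite mulrA; lra.
Qed.
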